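(* Let $\alpha$ be a countable ordinal. (a) If $\alpha < \omega^\omega$ then $T(n, \alpha) < \infty$ for all integers $2 \le n < \omega$. (b) If $\alpha \ge \omega^\omega$ then $T(n, \alpha) = \infty$ for all integers $2 \le n < \omega$.
   Context: For a chain (linearly ordered set) $C$ and a finite chain $n=\{0<1<\dots<n-1\}$, let $\mathrm{Emb}(n,C)$ be the set of order embeddings $n \hookrightarrow C$. The big Ramsey degree $T(n,C)$ is the least positive integer $t$ such that for every integer $k \ge 2$ and every coloring $\chi : \mathrm{Emb}(n, C) \to k$ there is a $U \subseteq C$ order-isomorphic to $C$ with $|\chi(\mathrm{Emb}(n, U))| \le t$; if no such $t$ exists, $T(n,C)=\infty$. By convention $T(0,C)=1$. *)

(* Defs.v *)
From HB Require Import structures.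
From mathcomp Require Import all_boot all_order finmap.
From mathcomp Require Import boolp classical_sets functions cardinality wochoice.

Set Implicit Arguments.
Unset Strict Implicit.
Unset Printing Implicit Defensive.

Local Open Scope classical_set_scope.

Definition Emb d1 d2 (A : orderType d1) (B : orderType d2) : Type :=
  {f : A -> B | {mono f : x y / (x <= y)%O}}.

Definition emb_fun d1 d2 (A : orderType d1) (B : orderType d2) (e : Emb A B) :
  A -> B := sval e.
Coercion emb_fun : Emb >-> Funclass.

Definition iso_to_subset d1 d2 (A : orderType d1) (B : orderType d2)
  (U : set B) : Prop := exists e : Emb A B, range e = U.

Section BigRamseyDegree.
Context {d : Order.disp_t}.
Implicit Types (C : orderType d) (n t k : nat).

(* The set of colors chi (Emb(n, U)), where Emb(n, U) is identified with the
   set of e in Emb(n, C) whose values all lie in U. *)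
Definition colors_on n C k (chi : Emb 'I_n C -> 'I_k) (U : set C) :
  {set 'I_k} :=
  [set c | `[< exists e : Emb 'I_n C, (forall i, U (e i)) /\ chi e = c >]]%SET.

Definition big_ramsey_bound n C t : Prop :=
  forall k, (2 <= k)%N -> forall chi : Emb 'I_n C -> 'I_k,
    exists U : set C, iso_to_subset C U /\ (#|colors_on chi U| <= t)%N.

(* [Some t] is the finite value t and [None] is the value infinity.  The
   convention T(0, C) = 1 need not be imposed: see [big_ramsey_degree0]. *)
Definition big_ramsey_degree n C : option nat :=
  match pselect (exists t, `[< (0 < t)%N /\ big_ramsey_bound n C t >]) with
  | left ex_bound => Some (ex_minn ex_bound)
  | right _ => None
  end.

Lemma big_ramsey_degree0 C : big_ramsey_degree 0 C = Some 1%N.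
Proof.
have b1 : big_ramsey_bound 0 C 1.
  move=> k _ chi; exists [set: C]; split.
    exists (exist _ id (fun x y => erefl)).
    by apply/seteqP; split => // x _; exists x.
  apply/card_le1_eqP => c c'; rewrite !inE.
  move=> [e [_ <-]] [e' [_ <-]]; congr (chi _).
  case: e e' => f ? [f' ?]; apply: eq_exist.
  by apply/funext => -[].
rewrite /big_ramsey_degree; case: pselect => [ex|[]]; last first.
  by exists 1%N; apply/asboolP.
case: ex_minnP => m /asboolP [m0 _] /(_ 1%N) m1; congr Some.
by apply/eqP; rewrite eqn_leq m0 andbT m1 //; apply/asboolP.
Qed.

End BigRamseyDegree.

(* Ordinals are represented by well-ordered types, up to isomorphism. *)

Definition ordinal_lt d1 d2 (A : orderType d1) (B : orderType d2) : Prop :=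
  exists b : B, iso_to_subset A [set y : B | (y < b)%O].

Definition initial_segment d (B : orderType d) (U : set B) : Prop :=
  forall x y : B, U x -> (y <= x)%O -> U y.

Definition ordinal_le d1 d2 (A : orderType d1) (B : orderType d2) : Prop :=
  exists U : set B, initial_segment U /\ iso_to_subset A U.

(* The ordinal power omega ^ omega: finitely supported functions f from omega to
   omega, compared at the largest argument where they differ, so that f
   represents the Cantor normal form ... + omega ^ 1 * f 1 + f 0. *)
Definition omega_omega : Type := {fsfun nat -> nat with 0%N}.
HB.instance Definition _ := Choice.on omega_omega.

Definition omega_omega_fun (f : omega_omega) : nat -> nat :=
  @fun_of_fsfun _ _ (fun=> 0%N) f.
Coercion omega_omega_fun : omega_omega >-> Funclass.

Definition antilex_lt (f g : omega_omega) : bool :=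
  `[< exists n, (f n < g n)%N /\ forall m, (n < m)%N -> f m = g m >].

Definition antilex_le (f g : omega_omega) : bool := (f == g) || antilex_lt f g.

Lemma omega_omega_bounded (f : omega_omega) :
  exists N, forall i, (N <= i)%N -> f i = 0%N.
Proof.
exists (\max_(i <- finsupp f) i).+1 => i Ni; apply: fsfun_dflt.
apply/negP => fi; move: Ni; rewrite ltnNge => /negP; apply.
exact: (@leq_bigmax_seq _ _ xpredT id).
Qed.

Lemma antilex_irr : irreflexive antilex_lt.
Proof. by move=> f; apply/negP => /asboolP [n []]; rewrite ltnn. Qed.

Lemma antilex_trans : transitive antilex_lt.
Proof.
move=> g f h /asboolP [n [fgn fg]] /asboolP [m [ghm gh]]; apply/asboolP.
have [nm|mn|nm] := ltngtP n m.
- exists m; split; first by rewrite fg.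
  by move=> i mi; rewrite fg ?gh //; exact: ltn_trans mi.
- exists n; split; first by rewrite -gh.
  by move=> i ni; rewrite fg ?gh //; exact: ltn_trans ni.
- subst m; exists n; split; first exact: ltn_trans ghm.
  by move=> i ni; rewrite fg ?gh.
Qed.

Lemma antilex_total (f g : omega_omega) :
  f != g -> antilex_lt f g || antilex_lt g f.
Proof.
move=> fg; have [N fN] := omega_omega_bounded f.
have [M gM] := omega_omega_bounded g.
have exd : exists i, f i != g i.
  apply: contrapT => nd; move/eqP: fg; apply; apply/fsfunP => i.
  by apply/eqP; apply: contrapT => /negP fgi; apply: nd; exists i.
have bd i : f i != g i -> (i <= maxn N M)%N.
  apply: contraR; rewrite -ltnNge gtn_max => /andP[Ni Mi].
  by rewrite fN ?gM // ltnW.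
case: (ex_maxnP exd bd) => n fgn maxn.
have agree m : (n < m)%N -> f m = g m.
  move=> nm; apply/eqP; apply: contraLR nm => fgm.
  by rewrite -leqNgt maxn.
move: fgn; rewrite neq_ltn => /orP[lt|lt]; apply/orP; [left|right];
  by apply/asboolP; exists n; split=> // m /agree.
Qed.

Fact omega_omega_display : Order.disp_t. Proof. exact: Order.Disp tt tt. Qed.

HB.instance Definition _ :=
  @Order.LtOrder.Build omega_omega_display omega_omega antilex_le antilex_lt
    _ _ (fun _ _ => erefl) (fun _ _ => erefl) (fun _ _ => erefl)
    antilex_irr antilex_trans antilex_total.

Lemma antilex_wf : well_founded (fun f g : omega_omega => antilex_lt f g).
Proof.
pose ltN N (f g : omega_omega) := exists n,
  [/\ (N <= n)%N, (f n < g n)%N & forall m, (n < m)%N -> f m = g m].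
pose acc := Acc (fun f g : omega_omega => antilex_lt f g).
have main N f : (forall g, ltN N g f -> acc g) -> acc f.
  elim: N f => [|N IH] f accN.
    by constructor => g /asboolP [n [gf eqgf]]; apply: accN; exists n.
  have [k] := ubnP (f N); elim: k f accN => [f _|k IHk f accN fk].
    by rewrite ltn0.
  apply: IH => g [n [Nn gf eqgf]].
  move: Nn; rewrite leq_eqVlt => /orP[/eqP Nn|Nn]; last by apply: accN; exists n.
  subst n; apply: IHk; last exact: leq_trans gf _.
  move=> h [n [Nn hg eqhg]]; apply: accN; exists n; split=> //.
    by rewrite -eqgf.
  by move=> m nm; rewrite eqhg // eqgf // (ltn_trans Nn).
move=> f; have [N fN] := omega_omega_bounded f; apply: (main N) => g.
by move=> [n [Nn]]; rewrite fN.
Qed.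

Lemma omega_omega_well_order : well_order (<=%O : rel omega_omega).
Proof.
apply: antisymmetric_well_order; first exact: Order.POrderTheory.le_anti.
move=> A [f]; elim/(well_founded_ind antilex_wf): f => f IH Af.
have [[g [gf Ag]]|nog] := pselect (exists g, antilex_lt g f /\ g \in A).
  exact: IH Ag.
exists f; split=> // g Ag; rewrite Order.TotalTheory.leNgt; apply/negP => gf.
by apply: nog; exists g.
Qed.

(* Main.v *)
Require Import Defs.
From mathcomp Require Import all_boot all_order finmap.
From mathcomp Require Import boolp classical_sets functions cardinality wochoice.

(* (a) Below [b < w^w] an n-tuple uses boundedly many coordinates.  Sending
   coordinates through a strictly increasing [h : nat -> nat] (except those from
   the leading difference with [b] upwards, which take finitely many values)
   embeds [alpha] into itself, and Ramsey's theorem provides an [h] after which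
   the color depends only on the relative position of the coordinates.

   (b) Fix an injection [idx : alpha -> nat] and code [x] by the finite set of
   records of [idx] met when going up from [x].  When [y] tends to a limit [x]
   from below, the code of [y] is the code of [x] followed by elements tending
   to infinity.  Color a tuple by the number of alternations between the codes
   of its first two points.  A copy of [w^w] contains points approximated in [p]
   nested levels by points of the copy, for all [p]; descending alternately
   towards [x] and [y] realizes the alternation numbers 1, 3, ..., 2p-1. *)

Set Implicit Arguments.
Unset Strict Implicit.
Unset Printing Implicit Defensive.
Import Order.TTheory.

(** * Infinite Ramsey theorem for increasing lists of naturals *)

Lemma increasing_selection (P : nat -> Prop) :
  (forall N, exists2 n, N <= n & P n) ->
  exists2 h : nat -> nat, {homo h : i j / i < j} & forall i, P (h i).
Proof.
move=> /(_ _)/cid2-/all_sig2[f leN Pf].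
exists (fix h i := if i is i'.+1 then f (h i').+1 else f 0).
  by apply: (homo_ltn ltn_trans) => i; exact: leN.
by case.
Qed.

Lemma infinite_pigeonhole (K : finType) (c : nat -> K) :
  exists2 h : nat -> nat, {homo h : i j / i < j} &
    exists k, forall i, c (h i) = k.
Proof.
have [[k /increasing_selection[h hinc hk]]|nok] :=
  pselect (exists k, forall N, exists2 n, N <= n & c n = k).
  by exists h => //; exists k.
have /(_ _)/cid-/all_sig[B Bk] k : exists N, forall n, N <= n -> c n <> k.
  apply: contrapT => /forallNP nN; apply: nok; exists k => N.
  by apply: contrapT => nn; apply: (nN N) => n Nn cn; apply: nn; exists n.
by case: (Bk (c (\max_k B k)) (\max_k B k)) => //; exact: leq_bigmax.
Qed.

Lemma homo_ltn_mono (h : nat -> nat) :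
  {homo h : i j / i < j} -> {mono h : i j / i < j}.
Proof. by move=> /(leq_mono)/leqW_mono. Qed.

(** Induction on [s]: repeated thinning makes the color depend on the first entry alone, and the
    pigeonhole principle then makes it constant. *)
Lemma ramsey (s : nat) (K : finType) (c : seq nat -> K) :
  exists2 h : nat -> nat, {homo h : i j / i < j} &
    exists k, forall a, sorted ltn a -> size a = s -> c (map h a) = k.
Proof.
elim: s K c => [|s IH] K c.
  by exists id => //; exists (c [::]) => a _ /size0nil->.
have /(_ _)/cid2-/all_sig2[r rinc /(_ _)/cid-/all_sig[q qP]] (g : nat -> nat) :
    exists2 r : nat -> nat, {homo r : i j / i < j} & exists k, forall a,
      sorted ltn a -> size a = s -> c (g 0 :: map (g \o S \o r) a) = k.
  have [r rinc [k rk]] := IH K (fun a => c (g 0 :: map (g \o S) a)).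
  by exists r => //; exists k => a asrt asz; rewrite -(rk a) // -map_comp.
(* Every [x j] with [i < j] lies in the range of [g i.+1], so [q (g i)] is the color of each
   increasing list of [s.+1] terms of [x] that starts at [x i]. *)
pose g := fix g i : nat -> nat :=
  if i is i'.+1 then g i' \o S \o r (g i') else id.
have ginc i : {homo g i : x y / x < y}.
  by elim: i => [|i IHi] x y xy //=; apply/IHi/rinc.
pose x i := g i 0.
have g_factor i j : i <= j -> exists p, x j = g i p.
  move=> ij; rewrite /x; elim: j ij 0 => [|j IHj] ij y.
    by move: ij; rewrite leqn0 => /eqP->; exists y.
  move: ij; rewrite leq_eqVlt => /orP[/eqP->|/IHj/(_ (r (g j) y).+1)[p xp]].
    by exists y.
  by exists p; rewrite -xp.
have xinc : {homo x : i j / i < j}.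
  by apply: (homo_ltn ltn_trans) => i; rewrite /x /= ginc.
have [h hinc [k hk]] := infinite_pigeonhole (q \o g).
exists (x \o h) => [i j ij|]; first exact/xinc/hinc.
exists k => -[//|i a] /= ia [asz]; rewrite -(hk i) /=.
have /(_ _)/cid-/all_sig[p px] j : exists p, i < j -> x (h j) = g (h i).+1 p.
  have [ij|_] := boolP (i < j); last by exists 0.
  by have [p xp] := g_factor _ _ (hinc _ _ ij); exists p.
have ai : {in a, forall j, i < j}.
  by apply/allP; move: ia; rewrite path_sortedE => [/andP[]//|];
    exact: ltn_trans.
rewrite -(qP (g (h i)) (map p a)) ?size_map //; last first.
  rewrite sorted_map; apply: (sub_in_sorted (P := mem a) _ _ (path_sorted ia)).
    move=> u v ua va uv; rewrite /= -(homo_ltn_mono (@ginc (h i).+1)).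
    by rewrite -!px ?ai //; apply/xinc/hinc.
  exact/allP.
congr (c (_ :: _)); rewrite -map_comp; apply/eq_in_map => j ja /=.
by rewrite px ?ai.
Qed.

Lemma sorted_superset (s : nat) (v : seq nat) : size v <= s ->
  exists a, [/\ sorted ltn a, size a = s & {subset v <= a}].
Proof.
move=> vs; pose w := sort leq (undup v).
have ws : size w <= s by rewrite size_sort (leq_trans (size_undup _)).
have memw : w =i v by move=> i; rewrite mem_sort mem_undup.
pose M := \max_(i <- v) i.
exists (w ++ iota M.+1 (s - size w)); split.
- rewrite sorted_pairwise; last exact: ltn_trans.
  rewrite pairwise_cat -!sorted_pairwise; try exact: ltn_trans.
  rewrite iota_ltn_sorted ltn_sorted_uniq_leq sort_uniq undup_uniq sort_sorted;
    last exact: leq_total.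
  rewrite !andbT; apply/allrelP => i j; rewrite memw mem_iota => iv /andP[Mj _].
  by apply: leq_trans Mj; rewrite ltnS; exact: (@leq_bigmax_seq _ _ xpredT id).
- by rewrite size_cat size_iota subnKC.
- by move=> i iv; rewrite mem_cat memw iv.
Qed.

(** * Reindexing coordinates, and finite degrees below [w^w] *)

Lemma omega_omega_of_fun (F : nat -> nat) (N : nat) :
  exists f : omega_omega, forall i, f i = if i < N then F i else 0.
Proof.
exists [fsfun i in [fset j in iota 0 N]%fset => F i | 0] => i.
by rewrite /omega_omega_fun fsfunE !inE /= mem_iota add0n.
Qed.

Lemma omega_omega_ext (f g : omega_omega) : (forall i, f i = g i) -> f = g.
Proof. by move=> fg; apply/fsfunP. Qed.

Lemma omega_omega_ltP (f g : omega_omega) :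
  reflect (exists n, f n < g n /\ forall m, n < m -> f m = g m) (f < g)%O.
Proof. exact: asboolP. Qed.

(** Keeping the coordinates from the leading difference with [b] upwards keeps [E f] below [b]. If
    [f < g < b] have leading difference [e], then either [e] is below both leading differences with
    [b], which then coincide, or it is below neither and [E] changes nothing from [e] upwards. *)
Lemma reindex_below (b : omega_omega) (N : nat) (h : nat -> nat) :
  (forall i, N <= i -> b i = 0) -> {homo h : i j / i < j} ->
  exists E : omega_omega -> omega_omega,
  [/\ forall f, (f < b)%O -> (E f < b)%O,
      forall f g : omega_omega, (f < g)%O -> (g < b)%O -> (E f < E g)%O
    & forall f : omega_omega, (f < b)%O -> exists n,
        (forall i, n <= i -> f i <= b i) /\
        forall i, E f i = if i < n then h (f i) else f i].
Proof.
move=> bN hinc.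
pose good (f Ef : omega_omega) := forall n, f n < b n ->
  (forall m, n < m -> f m = b m) ->
  forall i, Ef i = if i < n then h (f i) else f i.
have /(_ _)/cid-/all_sig[E EP] f : exists Ef, (f < b)%O -> good f Ef.
  have [/omega_omega_ltP[n [fn eqf]]|nfb] := boolP (f < b)%O; last by exists f.
  have [Ef EfP] :=
    omega_omega_of_fun (fun i => if i < n then h (f i) else f i) N.
  exists Ef => _ n' fn' eqf'.
  have -> : n' = n.
    have [nn|nn|//] := ltngtP n' n.
      by move: fn; rewrite eqf' // ltnn.
    by move: fn'; rewrite eqf // ltnn.
  move=> i; rewrite EfP; case: ltnP => // Ni.
  have nN : n < N by rewrite ltnNge; apply/negP => /bN bn; rewrite bn in fn.
  have ni := leq_trans nN Ni.
  by rewrite ltnNge ltnW //= eqf ?bN.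
exists E; split.
- move=> f /[dup]/EP Ef /omega_omega_ltP[n [fn eqf]].
  apply/omega_omega_ltP; exists n; rewrite (Ef n) // ltnn; split=> // m nm.
  by rewrite (Ef n) // ltnNge ltnW //= eqf.
- move=> f g fg gb; have fb := lt_trans fg gb.
  move: (EP _ fb) (EP _ gb) => Ef Eg.
  move/omega_omega_ltP: fg => [e [fge eqfg]].
  move/omega_omega_ltP: fb => [n [fn eqf]].
  move/omega_omega_ltP: gb => [p [gp eqg]].
  have enp : e < n -> p = n.
    move=> en; have [pn|np|//] := ltngtP p n.
      by move: fn; rewrite eqfg // eqg // ltnn.
    by move: gp; rewrite -eqfg ?(ltn_trans en) // eqf // ltnn.
  have epn : e < p -> p = n.
    move=> ep; have [pn|np|//] := ltngtP p n.
      by move: fn; rewrite eqfg ?(ltn_trans ep) // eqg // ltnn.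
    by move: gp; rewrite -eqfg // eqf // ltnn.
  have enep : (e < p) = (e < n).
    by apply/idP/idP => [/[dup]/epn->|/[dup]/enp->].
  apply/omega_omega_ltP; exists e; rewrite (Ef n) // (Eg p) // enep.
  split; first by case: ifP => // _; exact: hinc.
  move=> m em; rewrite (Ef n) // (Eg p) // eqfg //.
  have [en|ne] := ltnP e n; first by rewrite enp.
  rewrite ltnNge (leq_trans ne) ?(ltnW em) //= ltnNge.
  by rewrite (leq_trans _ (ltnW em)) // leqNgt enep ltnNge ne.
- move=> f /[dup]/EP Ef /omega_omega_ltP[n [fn eqf]].
  exists n; split=> [i|]; last exact: Ef.
  by rewrite leq_eqVlt => /orP[/eqP<-|/eqf->//]; exact: ltnW.
Qed.

Lemma emb_ext d1 d2 (A : orderType d1) (B : orderType d2) (e e' : Emb A B) :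
  (forall x, e x = e' x) -> e = e'.
Proof.
case: e e' => f fmono [f' f'mono] /= ff'.
by apply: eq_exist; apply/funext.
Qed.

Lemma finite_degree_below d (alpha : orderType d) (b : omega_omega)
    (e0 : Emb alpha omega_omega) (n : nat) :
  range e0 = [set y | (y < b)%O]%classic ->
  exists2 t, 0 < t & big_ramsey_bound n alpha t.
Proof.
move=> e0b; have [N bN] := omega_omega_bounded b.
(* [s] counts the coordinates of an entire tuple, since elements below [b] vanish from [N] on. *)
pose s := n * N; pose B := (\max_(i < N) b i).+1.
(* A pattern sends each coordinate either to its position in a sorted list of
   naturals or to an explicit value at most [max b]. *)
pose pattern := {ffun 'I_n -> {ffun 'I_N -> 'I_s + 'I_B}}.
have bB i : b i < B.
  rewrite ltnS; have [iN|/bN->//] := ltnP i N.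
  exact: (leq_bigmax (Ordinal iN)).
have e0_lt x : (e0 x < b)%O.
  have : range e0 (e0 x) by exists x.
  by rewrite e0b.
have e0_inj : injective e0 by apply: inc_inj; exact: (svalP e0).
pose coord a (q : 'I_s + 'I_B) : nat :=
  match q with inl r => nth 0 a r | inr v => v end.
have /(_ _)/cid2-/all_sig2[pt ptP pt0]
    (pa : {ffun 'I_N -> 'I_s + 'I_B} * seq nat) :
    exists2 f : omega_omega, forall i : 'I_N, f i = coord pa.2 (pa.1 i) &
      forall i, N <= i -> f i = 0.
  case: pa => p a; have [f fP] := omega_omega_of_fun
    (fun i => if insub i is Some i' then coord a (p i') else 0) N.
  exists f => i; first by rewrite fP ltn_ord valK.
  by rewrite fP ltnNge => ->.
(* The successor ensures positivity. *)
exists #|pattern|.+1 => // k _ chi.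
pose realized (P : pattern) (a : seq nat) (e : Emb 'I_n alpha) :=
  forall i, e0 (e i) = pt (P i, a).
have realized_uniq P a e e' : realized P a e -> realized P a e' -> e = e'.
  by move=> eP e'P; apply: emb_ext => i; apply: e0_inj; rewrite eP e'P.
have /(_ _)/cid-/all_sig[color colorP] (Pa : pattern * seq nat) :
    exists o, forall e, realized Pa.1 Pa.2 e -> o = Some (chi e).
  case: Pa => P a /=; have [[e eP]|ne] := pselect (exists e, realized P a e).
    by exists (Some (chi e)) => e' /(realized_uniq _ _ _ _ eP)<-.
  by exists None => e eP; case: ne; exists e.
(* Coloring a list by a function on patterns treats all patterns at once. *)
have [h hinc [K hK]] :=
  ramsey s (fun a => [ffun P : pattern => color (P, a)]).
have [E [Eb Einc EP]] := reindex_below bN hinc.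
have /(_ _)/cid-/all_sig[E' E'P] x : exists y, e0 y = E (e0 x).
  have : range e0 (E (e0 x)) by rewrite e0b; exact: Eb.
  by move=> [y _ <-]; exists y.
have e0_lt_mono : {mono e0 : x y / (x < y)%O} := leW_mono (svalP e0).
have E'_mono : {mono E' : x y / (x <= y)%O}.
  apply: le_mono => x y xy; rewrite -e0_lt_mono !E'P.
  by apply: Einc => //; rewrite e0_lt_mono.
exists (range E'); split; first by exists (exist _ E' E'_mono).
(* Each color attained on the copy is a value of [K] at some pattern. *)
rewrite -(card_imset _ (fun u v => @Some_inj _ u v)) ltnW // ltnS.
apply: leq_trans (leq_imset_card K pattern).
apply/subset_leq_card/fintype.subsetP => _ /imsetP[c + ->].
rewrite inE => /asboolP[e [eU <-]].
have /(_ _)/cid2-/all_sig2[x _ Ex] := eU.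
pose f i : omega_omega := e0 (x i).
have /(_ _)/cid-/all_sig[m mP] i := EP (f i) (e0_lt (x i)).
have [|a [a_sorted a_size a_mem]] := @sorted_superset s
    [seq f i l | i <- enum 'I_n, l <- iota 0 N].
  by rewrite size_allpairs size_enum_ord size_iota.
have /(_ _)/cid-/all_sig[q qP] (il : 'I_n * 'I_N) :
    exists q, coord (map h a) q = E (f il.1) il.2.
  case: il => i l /=; have [le_b ->] := mP i; case: ltnP => [_|/le_b ml].
    have fa : f i l \in a.
      apply: (a_mem (f i l)); apply/allpairsP; exists (i, l : nat).
      by rewrite /= mem_enum mem_iota add0n ltn_ord.
    have fs : index (f i l) a < s by rewrite -a_size index_mem.
    exists (inl (Ordinal fs)) => /=.
    by rewrite (nth_map 0) ?index_mem // nth_index.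
  by exists (inr (Ordinal (leq_ltn_trans ml (bB l)))).
pose P : pattern := [ffun i => [ffun l => q (i, l)]].
apply/imsetP; exists P => //.
rewrite -(hK a) // ffunE; apply/esym/colorP => i /=.
apply: omega_omega_ext => l; rewrite -Ex E'P; have [lN|Nl] := ltnP l N.
  by rewrite (ptP _ (Ordinal lN)) /= !ffunE qP.
have /omega_omega_ltP[p [Ep eqE]] := Eb _ (e0_lt (x i)).
rewrite pt0 // eqE ?bN //; apply: leq_trans Nl; rewrite ltnNge.
by apply/negP => /bN bp; rewrite bp in Ep.
Qed.

(** * Coordinate increments in [w^w], and alternation counts *)

(** The natural (Hessenberg) sum of [g] and [w^p * k]. *)
Definition add_coord (g : omega_omega) (p k : nat) : omega_omega :=
  [fsfun i in (p |` finsupp g)%fset => g i + (if i == p then k else 0) | 0].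

Lemma add_coordE g p k i :
  add_coord g p k i = g i + (if i == p then k else 0).
Proof.
rewrite /omega_omega_fun fsfunE !inE; case: eqVneq => //= _.
by case: ifPn => // gi; rewrite fsfun_dflt.
Qed.

Lemma add_coord0 g p : add_coord g p 0 = g.
Proof. by apply: omega_omega_ext => i; rewrite add_coordE if_same addn0. Qed.

Lemma add_coordD g p k l :
  add_coord (add_coord g p k) p l = add_coord g p (k + l).
Proof.
apply: omega_omega_ext => i.
by rewrite !add_coordE; case: ifP; rewrite ?addn0 ?addnA.
Qed.

Lemma add_coord_lt g p k l : k < l -> (add_coord g p k < add_coord g p l)%O.
Proof.
move=> kl; apply/omega_omega_ltP; exists p; rewrite !add_coordE eqxx ltn_add2l.
by split=> // m pm; rewrite !add_coordE gtn_eqF.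
Qed.

Lemma add_coord_ltS g p k : (add_coord g p k < add_coord g p.+1 1)%O.
Proof.
apply/omega_omega_ltP; exists p.+1; rewrite !add_coordE eqxx gtn_eqF //.
by rewrite ltn_add2l; split=> // m pm; rewrite !add_coordE !gtn_eqF // ltnW.
Qed.

(* The side (true for [A]) of the last element below [M] of the symmetric
   difference of [A] and [B], and the number of changes of side below [M]. *)
Fixpoint alternations (A B : pred nat) (M : nat) : option bool * nat :=
  if M is m.+1 then
    let: (last, v) := alternations A B m in
    if A m == B m then (last, v)
    else (Some (A m), v + (last == Some (~~ A m)))
  else (None, 0).

Lemma eq_alternations (A A' B B' : pred nat) M :
  (forall m, m < M -> A m = A' m) -> (forall m, m < M -> B m = B' m) ->
  alternations A B M = alternations A' B' M.
Proof.
elim: M => //= M IH AA BB; rewrite IH ?AA ?BB // => m mM.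
  by rewrite AA // ltnW.
by rewrite BB // ltnW.
Qed.

Lemma alternations_sym (A B : pred nat) M :
  alternations B A M =
  (omap negb (alternations A B M).1, (alternations A B M).2).
Proof.
elim: M => //= M ->; case: (alternations A B M) => last v /=.
rewrite eq_sym; case: eqVneq => //= AB.
have -> : B M = ~~ A M by case: (A M) (B M) AB => [] [].
by case: last => [[]|] //=; case: (A M).
Qed.

Lemma alternations_same (A : pred nat) M : alternations A A M = (None, 0).
Proof. by elim: M => //= M ->; rewrite eqxx. Qed.

Lemma alternations_stable (A B : pred nat) M M' : M <= M' ->
  (forall m, M <= m -> ~~ A m) -> (forall m, M <= m -> ~~ B m) ->
  alternations A B M' = alternations A B M.
Proof.
move=> /subnK<- A0 B0; elim: (M' - M) => //= k ->.
rewrite (negPf (A0 _ _)) ?leq_addl // (negPf (B0 _ _)) ?leq_addl //.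
by case: alternations.
Qed.

(** From [M] on only [A] has elements, so only the first of them can change the side. *)
Lemma alternations_extend (A B : pred nat) M m : M <= m -> A m ->
  (forall i, M <= i -> ~~ B i) ->
  alternations A B m.+1 = (Some true, (alternations A B M).2 +
    ((alternations A B M).1 == Some false)).
Proof.
move=> /subnK <- Am B0; move: Am.
have : ((alternations A B (m - M + M)) = alternations A B M) \/
  alternations A B (m - M + M) = (Some true, (alternations A B M).2 +
    ((alternations A B M).1 == Some false)).
  elim: (m - M) => [|k [IH|IH]] /=; first by left.
    rewrite IH (negPf (B0 _ _)) ?leq_addl //.
    case: (alternations A B M) => last v.
    by case: (A _) => /=; [right|left].
  rewrite IH (negPf (B0 _ _)) ?leq_addl //.
  by case: (A _) => /=; right; rewrite ?addn0.
rewrite /= => -[->|->] ->; rewrite (negPf (B0 _ _)) ?leq_addl //=.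
  by case: alternations.
by rewrite addn0.
Qed.

(** * Record codes and nested limit points *)

Section LimitPoints.
Context {d : Order.disp_t} {alpha : orderType d} (idx : alpha -> nat).

Definition records (x : alpha) : pred nat := fun n =>
  `[< exists y, [/\ (x <= y)%O, idx y = n &
        forall z, (x <= z)%O -> (z <= y)%O -> n <= idx z] >].

Lemma records_self x : records x (idx x).
Proof.
apply/asboolP; exists x; split=> // z xz zx.
by rewrite (le_anti (introT andP (conj xz zx))).
Qed.

Lemma records_le x n : records x n -> n <= idx x.
Proof. by move=> /asboolP[y [xy _]]; apply. Qed.

(** Points of [[y, x)] have index at least [M]: they neither give a record below [M] nor prevent one
    at or above [x]. *)
Lemma records_extend x y M : (y < x)%O -> idx x < M ->
  (forall z, (y <= z)%O -> (z < x)%O -> M <= idx z) ->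
  forall m, m < M -> records y m = records x m.
Proof.
move=> yx xM far m mM; apply: asbool_equiv_eq; split=> -[w [ww wm minw]].
  have xw : (x <= w)%O.
    rewrite leNgt; apply/negP => wx.
    by have := far w ww wx; rewrite wm leqNgt mM.
  exists w; split=> // z xz; apply: minw; exact/ltW/(lt_le_trans yx).
exists w; split=> //; first exact/ltW/(lt_le_trans yx).
move=> z yz zw; have [zx|xz] := ltP z x; last exact: minw.
exact: leq_trans (ltnW mM) (far _ yz zx).
Qed.

(* The condition on [idx] expresses that [y] is close to [x]: for injective
   [idx], only finitely many points have [idx] below [M]. *)
Fixpoint limit_point (U : alpha -> Prop) (p : nat) (x : alpha) : Prop :=
  if p is q.+1 then
    forall M : nat, exists2 y, limit_point U q y &
      (y < x)%O /\ forall z, (y <= z)%O -> (z < x)%O -> M <= idx z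
  else U x.

(** The descent stops at rank 1, as a limit of points of [U] may lie outside [U]. *)
Lemma limit_point_pred U p x : limit_point U p.+2 x -> limit_point U p.+1 x.
Proof.
elim: p x => [|p IH] x limx M; have [y limy [yx far]] := limx M.
  have [z Uz [zy zfar]] := limy M; exists z => //.
  split=> [|w zw wx]; first exact: lt_trans yx.
  by have [wy|yw] := ltP w y; [exact: zfar|exact: far].
by exists y => //; exact: IH.
Qed.

Lemma limit_point_le U p q x : p <= q ->
  limit_point U q.+1 x -> limit_point U p.+1 x.
Proof.
by move=> /subnK<-; elim: (q - p) => //= k IH /limit_point_pred.
Qed.

Lemma extend_left U p x y M : limit_point U p.+1 x ->
  idx x < M -> idx y < M ->
  exists x', [/\ limit_point U p x', (x' < x)%O, M <= idx x' &
    alternations (records x') (records y) (idx x').+1 =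
    (Some true, (alternations (records x) (records y) M).2 +
       ((alternations (records x) (records y) M).1 == Some false))].
Proof.
move=> limx xM yM; have [x' limx' [x'x far]] := limx M.
have Mx' := far _ (lexx _) x'x; exists x'; split=> //.
rewrite (alternations_extend Mx') ?records_self //.
  by rewrite (eq_alternations (records_extend x'x xM far) (fun _ _ => erefl)).
by move=> i Mi; apply/negP => /records_le; rewrite leqNgt (leq_trans yM).
Qed.

(** First [x'] adds code elements beyond [M] on the left, then [y'] adds elements beyond [idx x'] on
    the right; the second move is always one more alternation. *)
Lemma extend_both U p x y M : limit_point U p.+1 x -> limit_point U p.+1 y ->
  (x <= y)%O -> idx x < M -> idx y < M ->
  exists x' y' M', [/\ limit_point U p x', limit_point U p y', (x' < y')%O,
    idx x' < M' /\ idx y' < M' &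
    alternations (records x') (records y') M' =
    (Some false, ((alternations (records x) (records y) M).2 +
       ((alternations (records x) (records y) M).1 == Some false)).+1)].
Proof.
move=> limx limy xy xM yM.
have [x' [limx' x'x Mx' altx']] := extend_left limx xM yM.
have [y' limy' [y'y far]] := limy (idx x').+1.
have y'M := far _ (lexx _) y'y.
have yx' : idx y < (idx x').+1 by rewrite ltnS (leq_trans (ltnW yM)).
exists x', y', (idx y').+1; split=> //.
(* Otherwise [x'] lies in [[y', y)], where all indices exceed [idx x']. *)
- rewrite ltNge; apply/negP => y'x'.
  by have := far _ y'x' (lt_le_trans x'x xy); rewrite ltnn.
- by split; first exact: leqW.
rewrite alternations_sym (alternations_extend y'M) ?records_self //; last first.
  by move=> i x'i; apply/negP => /records_le; rewrite leqNgt x'i.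
rewrite (eq_alternations (records_extend y'y yx' far) (fun _ _ => erefl)).
by rewrite alternations_sym altx' /= addn1.
Qed.

(** Each round of [extend_both] costs one rank and, starting from a last side on the right, adds
    exactly two alternations. *)
Lemma alternate U p x y M v : limit_point U p x -> limit_point U p y ->
  (x < y)%O -> idx x < M -> idx y < M ->
  alternations (records x) (records y) M = (Some false, v) ->
  exists x' y', [/\ U x', U y', (x' < y')%O &
    (alternations (records x') (records y') (maxn (idx x') (idx y')).+1).2
    = v + p.*2].
Proof.
elim: p x y M v => [|p IH] x y M v limx limy xy xM yM alt_xy.
  exists x, y; split=> //; rewrite -(@alternations_stable _ _ _ M).
  - by rewrite alt_xy addn0.
  - by rewrite gtn_max xM.
  - move=> m; rewrite gtn_max => /andP[xm _].
    by apply/negP => /records_le; rewrite leqNgt xm.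
  - move=> m; rewrite gtn_max => /andP[_ ym].
    by apply/negP => /records_le; rewrite leqNgt ym.
have [x' [y' [M' [limx' limy' x'y' [x'M' y'M'] alt']]]] :=
  extend_both limx limy (ltW xy) xM yM.
have [x2 [y2 [Ux2 Uy2 lt2 alt2]]] := IH _ _ _ _ limx' limy' x'y' x'M' y'M' alt'.
exists x2, y2; split=> //; rewrite alt2 alt_xy /= addn1 doubleS.
by rewrite !addnS !addSn.
Qed.

Lemma alternations_attained U p x j : limit_point U p.+1 x -> j <= p ->
  exists x' y', [/\ U x', U y', (x' < y')%O &
    (alternations (records x') (records y') (maxn (idx x') (idx y')).+1).2
    = j.*2.+1].
Proof.
move=> limx jp; have {}limx := limit_point_le jp limx.
(* Starting from two equal codes, the first round yields just one alternation. *)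
have [x' [y' [M' [limx' limy' x'y' [x'M' y'M']]]]] :=
  extend_both limx limx (lexx x) (ltnSn _) (ltnSn _).
rewrite alternations_same => alt'.
have [x2 [y2 [? ? ? alt2]]] := alternate limx' limy' x'y' x'M' y'M' alt'.
by exists x2, y2; split=> //; rewrite alt2 add1n.
Qed.

(** For rank [p.+1], [x] is the supremum in [alpha] of the [u (add_coord g p k)]; the two bounds on
    [x] let the induction place rank [p] points between consecutive terms. *)
Lemma limit_point_exists (u : omega_omega -> alpha) p g :
  injective idx ->
  well_order (<=%O : rel alpha) -> {homo u : f h / (f < h)%O} ->
  exists x, [/\ limit_point (range u) p x, (u g <= x)%O &
                (x <= u (add_coord g p 1))%O].
Proof.
move=> idx_inj wo u_inc; elim: p g => [|p IH] g.
  exists (u g); split=> //=; first by exists g.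
  by apply/ltW/u_inc; rewrite -{1}(add_coord0 g 0) add_coord_lt.
pose ub := [pred x : alpha | `[< forall k, (u (add_coord g p k) <= x)%O >]].
have /wo[x [[/asboolP ubx minx] _]] : nonempty ub.
  exists (u (add_coord g p.+1 1)); apply/asboolP => k.
  exact/ltW/u_inc/add_coord_ltS.
exists x; split.
- move=> M.
  (* By injectivity of [idx], only finitely many points have index below [M], so one term of the
     sequence passes all those below [x]. *)
  have [k kP] : exists k, forall z, (z < x)%O -> idx z < M ->
      (z < u (add_coord g p k))%O.
    elim: M => [|M [k kP]]; first by exists 0.
    have [[z [zx zM]]|nz] := pselect (exists z, (z < x)%O /\ idx z = M).
      have [l zl] : exists l, (z < u (add_coord g p l))%O.
        apply: contrapT => /forallNP nl; have : z \in ub.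
          by apply/asboolP => l; rewrite leNgt; exact/negP/nl.
        by move/minx; rewrite leNgt zx.
      have u_le i j : i <= j -> (u (add_coord g p i) <= u (add_coord g p j))%O.
        by rewrite leq_eqVlt => /orP[/eqP->//|ij]; exact/ltW/u_inc/add_coord_lt.
      exists (maxn k l) => w wx; rewrite ltnS leq_eqVlt => /orP[/eqP|] wM.
        have -> : w = z by apply: idx_inj; rewrite wM.
        by apply: lt_le_trans zl _; apply/u_le/leq_maxr.
      by apply: lt_le_trans (kP _ wx wM) _; apply/u_le/leq_maxl.
    exists k => w wx; rewrite ltnS leq_eqVlt => /orP[/eqP wM|]; last exact: kP.
    by case: nz; exists w.
  have [y [limy ky yk]] := IH (add_coord g p k); exists y => //; split.
    apply: (le_lt_trans yk); apply: lt_le_trans (ubx k.+2).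
    by rewrite add_coordD; apply/u_inc/add_coord_lt; rewrite addn1.
  move=> z yz zx; rewrite leqNgt; apply/negP => /(kP _ zx).
  by rewrite ltNge (le_trans ky).
- by rewrite -{1}(add_coord0 g p).
- by apply: minx; apply/asboolP => k; exact/ltW/u_inc/add_coord_ltS.
Qed.

End LimitPoints.

(** * Infinite degrees from [w^w] on, and the theorem *)

Lemma infinite_degree_above d (alpha : orderType d) (v : Emb omega_omega alpha)
    (n t : nat) :
  well_order (<=%O : rel alpha) -> countable [set: alpha]%classic ->
  ~ big_ramsey_bound n.+2 alpha t.
Proof.
move=> wo /countable_injP[idx idxT] bound.
have idx_inj : injective idx by move=> x y; apply: idxT; rewrite inE.
(* The [t.+1] odd values up to [t.*2.+1] stay distinct colors; [inord] sends larger counts to 0. *)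
pose chi (e : Emb 'I_n.+2 alpha) : 'I_t.*2.+2 :=
  let x := e (inord 0) in let y := e (inord 1) in
  inord (alternations (records idx x) (records idx y)
           (maxn (idx x) (idx y)).+1).2.
have [U [[eU <-]]] := bound t.*2.+2 isT chi.
apply/negP; rewrite -ltnNge.
pose u f := eU (v f).
have u_inc : {homo u : f g / (f < g)%O}.
  by move=> f g fg; rewrite /u (leW_mono (svalP eU)) (leW_mono (svalP v)).
have [g0 _] := omega_omega_of_fun id 0.
have [x [limx _ _]] := limit_point_exists t.+1 g0 idx_inj wo u_inc.
pose color (j : 'I_t.+1) : 'I_t.*2.+2 := inord j.*2.+1.
have color_inj : injective color.
  have le j : j < t.+1 -> j.*2.+1 < t.*2.+2 by rewrite !ltnS leq_double.
  move=> i j /(congr1 val); rewrite /= !inordK ?le // => -[/double_inj].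
  exact: val_inj.
rewrite -[t.+1]card_ord -(card_imset _ color_inj).
apply/subset_leq_card/fintype.subsetP => _ /imsetP[j _ ->].
have [_ [_ [[f _ <-] [g _ <-] fg altfg]]] :=
  alternations_attained limx (valP j).
rewrite inE; apply/asboolP.
(* The pair is completed to a full tuple by the successors of [g], which leave the color
   unaffected. *)
pose w (i : 'I_n.+2) := u (if val i is 0 then f else add_coord g 0 i.-1).
have w_mono : {mono w : i k / (i <= k)%O}.
  apply: le_mono => -[[|i] ip] [[|k] kp] //= ik;
    rewrite /w /=; last exact/u_inc/add_coord_lt.
  apply: (lt_le_trans fg); rewrite -{1}(add_coord0 g 0).
  by case: k {kp ik} => // k; exact/ltW/u_inc/add_coord_lt.
exists (exist _ w w_mono); split=> [i|].
  by exists (v (if val i is 0 then f else add_coord g 0 i.-1)).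
have w0 : w (inord 0) = u f by rewrite /w /= inordK.
have w1 : w (inord 1) = u g by rewrite /w /= inordK //= add_coord0.
by rewrite /chi /emb_fun /= w0 w1 altfg.
Qed.

Theorem theorem6p4 (d : Order.disp_t) (alpha : orderType d)
    (alpha_wo : well_order (<=%O : rel alpha))
    (alpha_countable : countable [set: alpha]%classic) :
  (ordinal_lt alpha omega_omega ->
     forall n : nat, (2 <= n)%N ->
       exists t : nat, big_ramsey_degree n alpha = Some t)
  /\
  (ordinal_le omega_omega alpha ->
     forall n : nat, (2 <= n)%N -> big_ramsey_degree n alpha = None).
Proof.
split=> [[b [e0 e0b]] n _|[_ [_ [v _]]] [|[|n]] // _];
  rewrite /big_ramsey_degree; case: pselect => [ex|nex].
- by exists (ex_minn ex).
- have [t t0 bound] := finite_degree_below n e0b.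
  by case: nex; exists t; apply/asboolP.
- have [t /asboolP[_ bound]] := ex.
  by case: (infinite_degree_above v alpha_wo alpha_countable bound).
- by [].
Qed.
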